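(* $\mathfrak{ros}=\mathfrak{r}$, i.e. the minimal cardinality of a Rosenthal family equals the reaping number.
   Context: A Rosenthal matrix is an infinite matrix $M=(m_{k,n})_{k,n\in\mathbb{N}}$ of non-negative reals such that $\|M\|_\infty=\sup_{k\in\mathbb{N}}\sum_{n\in\mathbb{N}}m_{k,n}<\infty$. For $\varepsilon>0$ and $A\subseteq\mathbb{N}$, $M$ is $\varepsilon$-fragmented by $A$ if $\sum_{n\in A\setminus\{k\}}m_{k,n}\le\varepsilon$ for every $k\in A$. A family $\mathcal{F}$ of infinite subsets of $\mathbb{N}$ is a Rosenthal family if for every Rosenthal matrix $M$ and every $\varepsilon>0$ there is $A\in\mathcal{F}$ such that $M$ is $\varepsilon$-fragmented by $A$. $\mathfrak{ros}$ is the minimal cardinality of a Rosenthal family. The reaping number $\mathfrak{r}$ is the minimal cardinality of a family $\mathcal{F}$ of infinite subsets of $\mathbb{N}$ such that there is no $S\subseteq\mathbb{N}$ with $F\cap S$ and $F\setminus S$ both infinite for all $F\in\mathcal{F}$. *)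

(* Defs.v *)
From mathcomp Require Import all_boot all_order all_algebra.
From mathcomp Require Import all_classical all_reals ereal esum.

Set Implicit Arguments.
Unset Strict Implicit.
Unset Printing Implicit Defensive.
Import Order.TTheory GRing.Theory Num.Theory.

Local Open Scope classical_set_scope.
Local Open Scope card_scope.
Local Open Scope ring_scope.
Local Open Scope ereal_scope.

Section Rosenthal.
Context {R : realType}.

Definition row_sum_norm (M : nat -> nat -> R) : \bar R :=
  ereal_sup [set \esum_(n in [set: nat]) (M k n)%:E | k in [set: nat]].

Definition rosenthal_matrix (M : nat -> nat -> R) : Prop :=
  (forall k n, (0 <= M k n)%R) /\ row_sum_norm M < +oo.

Definition fragmented (eps : R) (M : nat -> nat -> R) (A : set nat) : Prop :=
  forall k, A k -> \esum_(n in A `\ k) (M k n)%:E <= eps%:E.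

End Rosenthal.

Definition infinite_family (F : set (set nat)) : Prop :=
  forall A, F A -> infinite_set A.

Definition rosenthal_family (R : realType) (F : set (set nat)) : Prop :=
  infinite_family F /\
  forall (M : nat -> nat -> R) (eps : R),
    rosenthal_matrix M -> (0 < eps)%R -> exists2 A, F A & fragmented eps M A.

Definition reaping_family (F : set (set nat)) : Prop :=
  infinite_family F /\
  ~ exists S : set nat, forall A, F A ->
      infinite_set (A `&` S) /\ infinite_set (A `\` S).

(* A cardinal is represented by a set of that cardinality, and equality of
   cardinals is equipotence [#=].  [least_card C] is a member of [C] of minimal
   cardinality; it is determined up to equipotence, and [least_cardP] shows that
   it exists as soon as [C] is nonempty (the default [set0] is then not used). *)
Definition least_card {T : Type} (C : set (set T)) : set T :=
  xget set0 [set X | C X /\ forall Y, C Y -> X #<= Y].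

Lemma least_cardP (T : pointedType) (C : set (set T)) :
  C !=set0 -> C (least_card C) /\ forall Y, C Y -> least_card C #<= Y.
Proof.
move=> [X0 CX0].
suff [X CX lX] : exists2 X, C X & forall Y, C Y -> X #<= Y.
  exact: (@xgetI _ _ [set X | C X /\ forall Y, C Y -> X #<= Y] X (conj CX lX)).
pose P (D : set (set T -> T)) :=
  (forall f, D f -> forall X, C X -> X (f X)) /\
  (forall f g X, D f -> D g -> C X -> f X = g X -> f = g).
have [D [[Dch Dinj] Dmax]] : exists D, P D /\ forall B, D `<` B -> ~ P B.
  apply: Zorn_bigcup => F FP Ftot; split=> [f [B FB Bf]|f g X].
    exact: (FP _ FB).1.
  move=> [A FA Af] [B FB Bg] CX.
  have [AB|BA] := Ftot _ _ FA FB.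
    by apply: (FP _ FB).2 => //; exact: AB.
  by apply: (FP _ FA).2 => //; exact: BA.
have [[X [CX Xsurj]]|noX] :=
    pselect (exists X, C X /\ forall x, X x -> exists2 f, D f & f X = x).
  exists X => // Y CY.
  have /choice[h hP] x : exists f : set T -> T, X x -> D f /\ f X = x.
    have [/Xsurj[f Df fx]|nXx] := pselect (X x).
      by exists f.
    by exists (fun=> point).
  apply/pcard_leP/injfunPex; exists (fun x => h x Y).
  - by move=> x /hP[Dx _]; exact: (Dch _ Dx).
  - move=> x y; rewrite !inE => Xx Xy /= hxy.
    have [[Dx xE] [Dy yE]] := (hP _ Xx, hP _ Xy).
    by rewrite -xE -yE (Dinj _ _ _ Dx Dy CY hxy).
have /choice[g gP] X : exists x, C X -> X x /\ forall f, D f -> f X <> x.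
  have [CX|nCX] := pselect (C X); last by exists point.
  apply: contrapT => H; apply: noX; exists X; split=> // x Xx.
  apply: contrapT => Hx; apply: H; exists x => _; split=> // f Df fx.
  by apply: Hx; exists f.
suff PDg : P (D `|` [set g]).
  exfalso; apply: (Dmax _ _ PDg); split=> [f Df|DgD]; first by left.
  have Dg : D g by apply: DgD; right.
  exact: (gP _ CX0).2 _ Dg erefl.
split=> [f [Df|->] X CX|f f' X].
- exact: (Dch _ Df).
- exact: (gP _ CX).1.
move=> [Df|->] [Df'|->] CX ff' //.
- exact: (Dinj _ _ _ Df Df' CX).
- by case: ((gP _ CX).2 _ Df).
- by case: ((gP _ CX).2 _ Df').
Qed.

Lemma reaping_family_infinite_sets :
  reaping_family [set A : set nat | infinite_set A].
Proof.
split=> // -[S split_S]; have [finS|infS] := pselect (finite_set S).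
  by have [+ _] := split_S _ infinite_nat; rewrite setTI; apply.
by have [_] := split_S _ infS; rewrite setDv; apply.
Qed.

Definition ros (R : realType) : set (set nat) :=
  least_card [set F | rosenthal_family R F].

Definition reaping_number : set (set nat) :=
  least_card [set F | reaping_family F].

(* Main.v *)
(* Every nonnegative matrix with bounded rows admits, for every eps, a finite
   colouring of the indices whose colour classes all eps-fragment it: the entries
   on either side of the diagonal form an acyclic weighted digraph, which a greedy
   K-colouring of an initial segment makes K times lighter inside each class, and
   an ultrafilter passes to the limit of the segments.  A reaping family F can be
   enlarged, within the cardinality of F * F = F, to a family having a
   monochromatic member for every finite colouring; that family is Rosenthal.

   Conversely, if no family of cardinality at most that of F is reaping, then
   splitting F again and again yields disjoint sets P_0, P_1, ... that all meet
   every member of F in an infinite set.  Let M k n be 1 if k is in P_n and 0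
   otherwise: each A in F contains, for every n in A, some k <> n in P_n, so that A
   does not 1/2-fragment M. *)
Require Import Defs.
From mathcomp Require Import finmap.
From mathcomp Require Import all_boot all_order all_algebra.
From mathcomp Require Import all_classical all_reals.
From mathcomp Require Import ereal esum sequences.

Set Implicit Arguments.
Unset Strict Implicit.
Unset Printing Implicit Defensive.
Import Order.TTheory GRing.Theory Num.Theory.

Local Open Scope classical_set_scope.
Local Open Scope card_scope.

(** * Cardinal arithmetic: comparability and squares of infinite sets *)

Lemma card_leE (T : Type) (U : pointedType) (A : set T) (B : set U) :
  A #<= B <-> exists2 f : T -> U, (forall x, A x -> B (f x)) &
    (forall x y, A x -> A y -> f x = f y -> x = y).
Proof.
split=> [/pcard_leP/injfunPex[f fAB finj]|[f fAB finj]].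
  by exists f => // x y Ax Ay; apply: finj; rewrite inE.
apply/pcard_leP/injfunPex; exists f => // x y.
by rewrite !inE => Ax Ay; apply: finj.
Qed.

(** Comparability is the existence of a least cardinal among two. *)
Lemma card_le_total (T : pointedType) (A B : set T) : A #<= B \/ B #<= A.
Proof.
have [|] := @least_cardP T [set A; B]; first by exists A; left.
move=> [->|->] lec; [left|right]; apply: lec; [by right|by left].
Qed.

Lemma card_le_setX (T1 T2 : Type) (U1 U2 : pointedType)
    (A1 : set T1) (A2 : set T2) (B1 : set U1) (B2 : set U2) :
  A1 #<= B1 -> A2 #<= B2 -> A1 `*` A2 #<= B1 `*` B2.
Proof.
move=> /card_leE[f fAB finj] /card_leE[g gAB ginj].
apply/card_leE; exists (fun u => (f u.1, g u.2)).
  by move=> [a b] [/= Aa Ab]; split; [exact: fAB|exact: gAB].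
move=> [a b] [a' b'] [/= Aa Ab] [/= Aa' Ab'] [/finj -> // /ginj -> //].
Qed.

Section square.
Context {T : pointedType} (X : set T).
Implicit Type G : set ((T * T) * T).

Definition diag_dom G : set T := [set a | exists c, G ((a, a), c)].

(* [G] is the graph of an injection of [Y `*` Y] into [Y], where [Y := diag_dom G]
   is a subset of [X]; single-valuedness is not imposed, choice supplies it. *)
Definition pairing_graph G := [/\ diag_dom G `<=` X,
  forall a b c, G ((a, b), c) -> [/\ diag_dom G a, diag_dom G b & diag_dom G c],
  forall a b, diag_dom G a -> diag_dom G b -> exists c, G ((a, b), c) &
  forall u v c, G (u, c) -> G (v, c) -> u = v].

(** Each clause starts from at most two triples of [G], so it can be checked in one pairing graph
    [D] inside [G] that contains both. This serves unions of chains. *)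
Lemma pairing_graph_directed G :
  (forall u v, G u -> G v ->
    exists D, [/\ pairing_graph D, D `<=` G, D u & D v]) ->
  pairing_graph G.
Proof.
move=> dirG.
have sub D : D `<=` G -> diag_dom D `<=` diag_dom G.
  by move=> DG a [c Dc]; exists c; exact: DG.
split=> [a [c Gc]|a b c Gc|a b [c Gc] [d Gd]|u v c Gu Gv].
- by have [D [[+ _ _ _] _ Dc _]] := dirG _ _ Gc Gc; apply; exists c.
- have [D [[_ + _ _] DG Dc _]] := dirG _ _ Gc Gc.
  by move=> /(_ _ _ _ Dc)[? ? ?]; split; exact: (sub D).
- have [D [[_ _ + _] DG Dc Dd]] := dirG _ _ Gc Gd.
  by move=> /(_ a b)[||e De]; [exists c|exists d|exists e; exact: DG].
- by have [D [[_ _ _ +] DG Dc Dd]] := dirG _ _ Gu Gv; apply; eassumption.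
Qed.

Lemma pairing_graph_maximal G0 : pairing_graph G0 ->
  exists G, [/\ pairing_graph G, G0 `<=` G &
    forall G', pairing_graph G' -> G `<=` G' -> G' `<=` G].
Proof.
move=> G0P.
(* Zorn's lemma is applied to the part added to [G0], so that the empty chain is bounded by [G0]
   itself. *)
have [F Fsub Ftot|D [DP Dmax]] :=
  @Zorn_bigcup _ [set D | pairing_graph (G0 `|` D)].
  rewrite /=; apply: pairing_graph_directed => u v Gu Gv.
  have common D u' v' : F D -> (G0 `|` D) u' -> (G0 `|` D) v' ->
      exists D, [/\ pairing_graph D, D `<=` G0 `|` \bigcup_(X in F) X, D u' & D v'].
    move=> FD Du Dv; exists (G0 `|` D); split=> //; first exact: Fsub.
    by apply: setUS; exact: bigcup_sup.
  case: Gu => [Gu|[D FD Du]]; case: Gv => [Gv|[E FE Ev]].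
  - by exists G0; split=> // x; left.
  - by apply: common FE _ _; [left|right].
  - by apply: common FD _ _; [right|left].
  - have [DE|ED] := Ftot _ _ FD FE.
      by apply: common FE _ _; right => //; exact: DE.
    by apply: common FD _ _; right => //; exact: ED.
exists (G0 `|` D); split=> //.
move=> G' G'P GG' x G'x; apply: contrapT => nGx.
apply: (Dmax G').
  split; first by move=> y Dy; apply: GG'; right.
  by move=> G'D; apply: nGx; right; exact: G'D.
by rewrite /= setUidr // => y G0y; apply: GG'; left.
Qed.

(** Hessenberg's theorem: the domain [Y] of a maximal pairing graph has the size of [X], since
    otherwise a copy of [Y] in its complement would allow an extension. *)
Lemma infinite_card_setXX : infinite_set X -> X `*` X #<= X.
Proof.
move=> /infiniteP/card_leE[j jX jinj].
have {}jinj m n : j m = j n -> m = n by exact: jinj.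
(* Starting from a pairing on the range of [j] provides [Y] with the distinct tags [j 0] and
   [j 1]. *)
pose G0 := [set ((j u.1, j u.2), j (pickle u)) | u in [set: nat * nat]].
have domG0 n : diag_dom G0 (j n) by exists (j (pickle (n, n))), (n, n).
have [|G [[GX Gdom Gtot Ginj] G0G Gmax]] := @pairing_graph_maximal G0.
  split=> [a [c [[m n] _ [<- _ _]]]|a b c [[m n] _ [<- <- <-]]| |u v c].
  - exact: jX.
  - by split.
  - move=> _ _ [_ [[m n] _ [<- _ _]]] [_ [[m' n'] _ [<- _ _]]].
    by exists (j (pickle (m, m'))), (m, m').
  - move=> [[m n] _ [<- <-]] [[m' n'] _ [<- /jinj/(pcan_inj pickleK)[-> ->]]].
    by [].
set Y := diag_dom G in GX Gdom Gtot.
have Yj n : Y (j n) by have [c G0c] := domG0 n; exists c; exact: G0G.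
have /choice[p pP] (u : T * T) : exists c, Y u.1 -> Y u.2 -> G (u, c).
  have [[Y1 Y2]|nY] := pselect (Y u.1 /\ Y u.2); last first.
    by exists point => Y1 Y2; case: nY.
  by case: u Y1 Y2 => a b /= Ya Yb; have [c Gc] := Gtot _ _ Ya Yb; exists c.
have pY a b : Y a -> Y b -> Y (p (a, b)).
  by move=> Ya Yb; have [] := Gdom _ _ _ (pP (a, b) Ya Yb).
have pinj a b a' b' : Y a -> Y b -> Y a' -> Y b' ->
    p (a, b) = p (a', b') -> a = a' /\ b = b'.
  move=> Ya Yb Ya' Yb' e; have Ga := pP (a, b) Ya Yb.
  by have := pP (a', b') Ya' Yb'; rewrite -e => /(Ginj _ _ _ Ga)[-> ->].
have YYY : Y `*` Y #<= Y.
  apply/card_leE; exists p; first by move=> [a b] []; exact: pY.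
  by move=> [a b] [a' b'] [? ?] [? ?] /pinj[] // -> ->.
suff XY : X #<= Y.
  apply: (card_le_trans (card_le_setX XY XY)).
  by apply: (card_le_trans YYY); exact: subset_card_le.
have [/card_leE[i iY iinj]|/card_leE[h hX hinj]] := card_le_total (X `\` Y) Y.
  apply/card_leE; exists (fun a => if a \in Y then p (j 0, a) else p (j 1, i a)).
    move=> a Xa; case: ifPn => [|/negP]; rewrite inE => Ya; apply: pY => //.
    exact: iY.
  move=> a b Xa Xb; case: ifPn => [|/negP]; rewrite inE => Ya;
    case: ifPn => [|/negP]; rewrite inE => Yb.
  - by move=> /pinj[].
  - by move=> /pinj[] //; [exact: iY|move=> /jinj].
  - by move=> /pinj[] //; [exact: iY|move=> /jinj].
  - by move=> /pinj[] //; [exact: iY|exact: iY|move=> _ /iinj ->].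
(* [h] copies [Y] into its complement; the new pairs of [Y `|` h @` Y] are sent
   into [h @` Y], tagged by the side on which each component lies. *)
exfalso.
pose emb (t : bool) x := if t then h x else x.
have embinj t s x y : Y x -> Y y -> emb t x = emb s y -> t = s /\ x = y.
  move=> Yx Yy; case: t; case: s => //= e.
  - by split=> //; exact: hinj.
  - by have [_] := hX _ Yx; rewrite e.
  - by have [_] := hX _ Yy; rewrite -e.
pose new (t s : bool) x y := h (p (p (j t, j s), p (x, y))).
pose N := [set u : (T * T) * T | exists t s x y, [/\ t || s, Y x, Y y &
  u = ((emb t x, emb s y), new t s x y)]].
have domE a : diag_dom (G `|` N) a <-> exists t x, Y x /\ a = emb t x.
  split=> [[c [Gc|[t [s [x [y [ts Yx Yy [-> _ _]]]]]]]]|[[] [x [Yx ->]]]].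
  - by exists false, a; split=> //; exists c.
  - by exists t, x.
  - by exists (new true true x x); right; exists true, true, x, x.
  - by have [c Gc] := Yx; exists c; left.
have N_emb t x : Y x -> diag_dom (G `|` N) (emb t x).
  by move=> Yx; apply/domE; exists t, x.
have Yq (t s : bool) x y : Y x -> Y y -> Y (p (p (j t, j s), p (x, y))).
  by move=> Yx Yy; apply: (pY _ _ (pY _ _ _ _) (pY _ _ _ _)).
have newinj t s x y t' s' x' y' : Y x -> Y y -> Y x' -> Y y' ->
    new t s x y = new t' s' x' y' -> [/\ t = t', s = s', x = x' & y = y'].
  move=> Yx Yy Yx' Yy' /(hinj _ _ (Yq _ _ _ _ Yx Yy) (Yq _ _ _ _ Yx' Yy')).
  case/pinj; try exact: pY.
  case/pinj => // /jinj + /jinj + /pinj[] //.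
  by move: t s t' s' => [] [] [] [].
have GN : G `|` N `<=` G.
  apply: Gmax; last by move=> u; left.
  split=> [a /domE[[] [x [Yx ->]]]|a b c [Gc|]|a b|u v c].
  - by have [] := hX _ Yx.
  - exact: GX.
  - by have [Ya Yb Yc] := Gdom _ _ _ Gc; split; exact: (N_emb false).
  - move=> [t [s [x [y [ts Yx Yy [-> -> ->]]]]]]; split; try exact: N_emb.
    by apply: (N_emb true); exact: Yq.
  - move=> /domE[t [x [Yx ->]]] /domE[s [y [Yy ->]]].
    have [ts|] := boolP (t || s).
      by exists (new t s x y); right; exists t, s, x, y.
    by case: t; case: s => //= _; have [c Gc] := Gtot _ _ Yx Yy; exists c; left.
  - have nYnew t s x y : Y x -> Y y -> ~ Y (new t s x y).
      by move=> Yx Yy; have [] : (X `\` Y) (new t s x y) by apply: hX; exact: Yq.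
    move=> [Gu|[t [s [x [y [ts Yx Yy [-> e]]]]]]] [Gv|[t' [s' [x' [y' [ts' Yx' Yy' [-> e']]]]]]].
    + exact: Ginj Gu Gv.
    + by case: u Gu => a b /Gdom[_ _ Yc]; case: (nYnew t' s' x' y'); rewrite -?e'.
    + by case: v Gv => a b /Gdom[_ _ Yc]; case: (nYnew t s x y); rewrite -?e.
    + by move: e'; rewrite e => /newinj[] // -> -> -> ->.
have /GN/Gdom[Yhj _ _] : (G `|` N) ((h (j 0), h (j 0)), new true true (j 0) (j 0)).
  by right; exists true, true, (j 0), (j 0).
by have [] := hX _ (Yj 0).
Qed.

End square.

(** * Infinite sets of naturals and the splitting of countable families *)

Lemma infinite_nat_gt (A : set nat) m : infinite_set A -> exists2 n, A n & m < n.
Proof.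
move=> infA; apply: contrapT => noA; apply: infA.
apply: sub_finite_set (finite_II m.+1) => n An /=.
by rewrite ltnS leqNgt; apply/negP => mn; apply: noA; exists n.
Qed.

Lemma finite_nat_bound (A : set nat) : finite_set A -> exists m, A `<=` `I_m.
Proof.
move=> /finite_seqP[s ->]; exists (\max_(i <- s) i).+1 => i /= si.
by rewrite ltnS; exact: leq_bigmax_seq.
Qed.

Lemma infinite_inj (T : pointedType) (A : set T) (f : nat -> T) :
  (forall n, A (f n)) -> injective f -> infinite_set A.
Proof. by move=> fA finj; apply/infiniteP/card_leE; exists f => // m n _ _ /finj. Qed.

(** An increasing sequence [x] visits every member of [F] at infinitely many even and infinitely
    many odd times; its values at even times form [S]. *)
Lemma countable_split (F : set (set nat)) : infinite_family F -> countable F ->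
  exists S : set nat, forall A, F A ->
    infinite_set (A `&` S) /\ infinite_set (A `\` S).
Proof.
move=> infF /card_leE[f _ finj].
have /choice[a aP] (n : nat) : exists A, infinite_set A /\ forall B, F B -> f B = n -> A = B.
  have [[A [FA <-]]|noA] := pselect (exists A, F A /\ f A = n).
    exists A; split; first exact: infF.
    by move=> B FB fBA; apply: (finj _ _ FA FB); rewrite fBA.
  exists setT; split; first exact: infinite_nat.
  by move=> B FB fB; case: noA; exists B.
have /choice[nxt nxtP] (u : nat * nat) : exists n, a u.1 n /\ u.2 < n.
  by have [n an un] := infinite_nat_gt u.2 (aP u.1).1; exists n.
(* Halving [t] makes each even time and its successor visit the same set; every set recurs through
   the second component of the decoded pair. *)
pose i t := (odflt (0, 0) (unpickle t./2)).1.
pose x := fix x t := if t is t'.+1 then nxt (i t, x t') else nxt (i 0, 0).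
have xa t : a (i t) (x t).
  by case: t => [|t]; [exact: (nxtP (i 0, 0)).1|exact: (nxtP (i t.+1, x t)).1].
have xS t : x t < x t.+1 by exact: (nxtP (i t.+1, x t)).2.
have xinj : injective x.
  have xlt := homo_ltn ltn_trans xS.
  by move=> s t e; case: (ltngtP s t) => // /xlt; rewrite e ltnn.
have a_sub (n : nat) (b : bool) : let y := fun j : nat => x (b + (pickle (n, j)).*2) in
    (forall j, a n (y j)) /\ injective y.
  split=> [j|j k /xinj/addnI/double_inj/(pcan_inj pickleK)[]//].
  have := xa (b + (pickle (n, j)).*2).
  by rewrite /i half_bit_double pickleK.
exists [set x t | t in [set t | ~~ odd t]] => A FA.
have -> : A = a (f A) by rewrite ((aP _).2 _ FA).
have [ya0 yinj0] := a_sub (f A) false; have [ya1 yinj1] := a_sub (f A) true.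
split.
  apply: (infinite_inj _ yinj0) => j; split; first exact: ya0.
  by eexists; [|reflexivity]; rewrite /= add0n odd_double.
apply: (infinite_inj _ yinj1) => j; split; first exact: ya1.
by move=> [t nodd /xinj te]; move: nodd; rewrite te /= odd_double.
Qed.

Lemma reaping_family_infinite (F : set (set nat)) :
  reaping_family F -> infinite_set F.
Proof.
move=> [infF nsplit] /finite_set_countable/(countable_split infF) [S SF].
by apply: nsplit; exists S.
Qed.

(** * From Rosenthal families to reaping families *)

Lemma rosenthal_reaping (R : realType) (F : set (set nat)) :
  rosenthal_family R F -> exists2 G, reaping_family G & G #<= F.
Proof.
move=> [infF rosF]; apply: contrapT => noG.
(* The traces of [F] on [T] form a family no larger than [F]; if all are infinite, the family is not
   reaping and one [S] splits every trace. *)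
have /choice[sp spP] (T : set nat) : exists S : set nat,
    (forall A, F A -> infinite_set (A `&` T)) ->
    forall A, F A -> infinite_set (A `&` T `&` S) /\ infinite_set (A `&` T `\` S).
  have [AT|nAT] := pselect (forall A, F A -> infinite_set (A `&` T)); last first.
    by exists set0 => /nAT.
  apply: contrapT => noS; apply: noG.
  exists [set A `&` T | A in F]; last exact: card_image_le.
  split=> [_ [A FA <-]|[S SP]]; first exact: AT.
  by apply: noS; exists S => _ A FA; apply: SP; exists A.
pose T := fix T n := if n is n'.+1 then T n' `\` sp (T n') else setT.
have infT n A : F A -> infinite_set (A `&` T n).
  elim: n A => [A FA|n IHn A FA]; first by rewrite setIT; exact: infF.
  by have [_] := spP _ IHn A FA; rewrite /= setIDA.
pose P n := T n `&` sp (T n).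
have infP n A : F A -> infinite_set (A `&` P n).
  by move=> FA; rewrite setIA; have [] := spP _ (infT n) A FA.
have disjP m n k : m < n -> P m k -> ~ T n k.
  elim: n => // n IHn; rewrite ltnS leq_eqVlt => /orP[/eqP <-|mn] Pk /= [Tn nsp].
    by apply: nsp; case: Pk.
  exact: IHn.
(* The pieces are disjoint, so [f k] is the index of the one containing [k]. Points in no piece may
   get [0]: every row of [M] still has exactly one entry 1. *)
have /choice[f fP] k : exists n, forall m, P m k -> n = m.
  have [[n Pn]|noP] := pselect (exists n, P n k); last first.
    by exists 0 => m Pm; case: noP; exists m.
  exists n => m Pm; case: (ltngtP m n) => // mn.
    by case: (disjP _ _ _ mn Pm); case: Pn.
  by case: (disjP _ _ _ mn Pn); case: Pm.
pose M k n : R := (n == f k)%:R%R.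
have rosM : rosenthal_matrix M.
  split=> [k n|]; first exact: ler0n.
  apply: (@le_lt_trans _ _ 1%E); last exact: ltry.
  apply: ge_ereal_sup => _ [k _ <-].
  rewrite (_ : esum setT _ = esum [set f k] (fun=> 1%:E))%E.
    by rewrite esum_set1 ?lee_fin ?ler01.
  rewrite [RHS]esum_mkcond; apply: eq_esum => n _; rewrite /M.
  have [->|/eqP nfk] := eqVneq n (f k); first by rewrite mem_set.
  by rewrite memNset.
have [|A FA fragA] := rosF M (2^-1)%R rosM; first by rewrite invr_gt0 ltr0n.
have [n An] := infinite_setN0 (infF _ FA).
(* Taking [k] beyond [n] puts the entry 1 in column [n] of row [k] off the diagonal. *)
have [k [Ak Pk] nk] := infinite_nat_gt n (infP n A FA).
suff : ((1 : R)%:E <= (2^-1)%:E)%E.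
  by rewrite lee_fin invf_ge1 ?ltr0n // lern1.
apply: le_trans (fragA k Ak); apply: esum_ge; exists [set n].
  split; first exact: finite_set1.
  by move=> _ ->; split=> // nk'; move: nk; rewrite nk' ltnn.
by rewrite fsbig_set1 /M (fP _ _ Pk) eqxx.
Qed.

(** * From reaping families to finite colourings *)

(* A family closed under the copies [e A @` B], with [e A] an injection of [nat]
   into [A], handles [n.+1] colours: [A] decides one colour, and [B] handles the
   [n] others on [A]. *)
Lemma reaping_coloring (F : set (set nat)) : reaping_family F ->
  exists H : set (set nat), [/\ infinite_family H, H #<= F &
    forall n (c : nat -> nat), (forall k, c k <= n) ->
      exists2 A, H A & exists v, forall k, A k -> c k = v].
Proof.
move=> reapF; have [infF nsplitF] := reapF.
have natF : [set: nat] #<= F by apply/infiniteP; exact: reaping_family_infinite.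
(* Removing initial segments turns a member almost inside or almost outside a set into one exactly
   so. *)
pose F1 := [set u.1 `\` `I_u.2 | u in F `*` [set: nat]].
have F1F : F1 #<= F.
  apply: card_le_trans (card_image_le _ _) _.
  apply: card_le_trans (card_le_setX (card_lexx _) natF) _.
  exact/infinite_card_setXX/reaping_family_infinite.
have infF1 : infinite_family F1.
  by move=> _ [[A j] [/= FA _] <-]; apply: infinite_setD; [exact: infF|exact: finite_II].
have F1_tail A j : F A -> F1 (A `\` `I_j) by move=> FA; exists (A, j).
have FF1 : F `<=` F1.
  by move=> A FA; have := F1_tail A 0 FA; rewrite II0 setD0.
have F1_split S : exists2 A, F1 A & A `<=` S \/ A `<=` ~` S.
  apply: contrapT => noA; apply: nsplitF; exists S => A FA.
  split=> /finite_nat_bound[m mP]; apply: noA;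
      (exists (A `\` `I_m); first exact: F1_tail).
    by right=> k [Ak km] Sk; apply: km; exact: mP.
  by left=> k [Ak km]; apply: contrapT => nSk; apply: km; exact: mP.
have infsF1 : infinite_set F1.
  by apply: reaping_family_infinite; split=> // -[S SP]; apply: nsplitF; exists S => A /FF1/SP.
have /choice[e eP] (A : set nat) : exists e : nat -> nat,
    infinite_set A -> (forall n, A (e n)) /\ injective e.
  have [finA|/infiniteP/card_leE[e eA einj]] := pselect (finite_set A).
    by exists id.
  by exists e => _; split=> [n|m n]; [exact: eA|exact: einj].
(* A left inverse [q] of a pairing on [F1] lets one member of [F1] code two. *)
have [q qP] : exists q : set nat -> set nat * set nat,
    forall A B, F1 A -> F1 B -> exists2 C, F1 C & q C = (A, B).
  have /card_leE[p pF1 pinj] := infinite_card_setXX infsF1.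
  have /choice[q qP] C : exists u, forall u', (F1 `*` F1) u' -> p u' = C -> u' = u.
    have [[u [Fu puC]]|nou] := pselect (exists u, (F1 `*` F1) u /\ p u = C).
      by exists u => u' Fu' pu'; apply: pinj => //; rewrite puC.
    by exists point => u' Fu' pu'; case: nou; exists u'.
  exists q => A B FA FB; exists (p (A, B)); first exact: pF1.
  by rewrite -(qP (p (A, B)) (A, B)).
(* One code [C] carries all the members needed for nested copies of depth [n], so [F1] and a number
   index [H]. Nothing is known of codes outside the range of the pairing, hence the restriction to
   infinite sets in [H]. *)
pose g := fix g n C := if n is n'.+1 then e (q C).1 @` g n' (q C).2 else C.
pose H := [set g u.2 u.1 | u in F1 `*` [set: nat]] `&` [set A | infinite_set A].
exists H; split=> [A []//||n c cn].
  apply: (card_le_trans (subset_card_le (@subIsetl _ _ _))).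
  apply: card_le_trans (card_image_le _ _) _.
  apply: card_le_trans (card_le_setX F1F natF) _.
  exact/infinite_card_setXX/reaping_family_infinite.
suff [C [F1C infC [v vP]]] : exists C, [/\ F1 C, infinite_set (g n C) &
    exists v, forall k, g n C k -> c k = v].
  by exists (g n C); [split=> //; exists (C, n)|exists v].
elim: n c cn => [|n IHn] c cn.
  have [A F1A _] := F1_split set0.
  exists A; split=> //; first exact: infF1.
  by exists 0 => k _; apply/eqP; rewrite -leqn0.
have inf_img A B : F1 A -> infinite_set B -> infinite_set (e A @` B).
  move=> F1A infB finAB; apply: infB.
  have [_ einj] := eP A (infF1 _ F1A).
  by rewrite -(eq_finite_set (inj_card_eq (in2W einj))).
(* Either [A] has colour [n.+1] throughout and only an infinite second component is needed, which a
   constant colouring supplies, or [A] avoids that colour and [c \o e A] uses one fewer. *)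
have [A F1A [AS|AS]] := F1_split [set k | c k = n.+1].
  have [D [F1D infD _]] := IHn (fun=> 0) (fun=> leq0n n).
  have [C F1C qC] := qP A D F1A F1D.
  exists C; split=> //=; rewrite qC /=; first exact: inf_img.
  exists n.+1 => _ [k _ <-]; apply: AS.
  by have [eA _] := eP A (infF1 _ F1A).
have [eA _] := eP A (infF1 _ F1A).
have [k|D [F1D infD [v vP]]] := IHn (c \o e A).
  have /eqP := AS _ (eA k).
  by have := cn (e A k); rewrite /= leq_eqVlt ltnS => /orP[->|].
have [C F1C qC] := qP A D F1A F1D.
exists C; split=> //=; rewrite qC /=; first exact: inf_img.
by exists v => _ [k Dk <-]; exact: vP.
Qed.

(** * Finite pavings of Rosenthal matrices *)

(** The lightest colour weighs at most the average. *)
Lemma light_color (R : realFieldType) (I : eqType) (s : seq I) (w : I -> R) K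
    (c : I -> 'I_K.+1) :
  exists i, (K.+1%:R * (\sum_(n <- s | c n == i) w n) <= \sum_(n <- s) w n)%R.
Proof.
pose S i := (\sum_(n <- s | c n == i) w n)%R.
case: (arg_minP S (isT : predT ord0)) => i _ iP; exists i.
rewrite [leRHS](partition_big c predT)//= mulr_natl.
rewrite -[X in (_ *+ X)%R](card_ord K.+1) -sumr_const.
by apply: ler_sum => j _; exact: iP.
Qed.

(** Colours are chosen from the end of the list: the head takes the colour lightest for its row on
    the tail. As it does not recur there, the choice disturbs no later condition. *)
Lemma greedy_coloring (R : realFieldType) (w : nat -> nat -> R) K (s : seq nat) :
  uniq s -> exists c : nat -> 'I_K.+1, forall s1 k s2, s = s1 ++ k :: s2 ->
    (K.+1%:R * (\sum_(n <- s2 | c n == c k) w k n) <= \sum_(n <- s2) w k n)%R.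
Proof.
elim: s => [_|x s IHs /= /andP[xs /IHs[c cP]]].
  by exists (fun=> ord0) => -[].
have [i iP] := light_color s (w x) c.
exists (fun n => if n == x then i else c n) => -[|y s1] k s2 /= [].
  move=> <- <-; rewrite eqxx; apply: le_trans iP.
  rewrite ler_pM2l ?ltr0n// big_seq_cond [leRHS]big_seq_cond.
  rewrite le_eqVlt; apply/orP; left; apply/eqP; apply: eq_bigl => n.
  by case: (eqVneq n x) => // ->; rewrite (negbTE xs).
move=> _ es; have ks : k != x.
  by apply: contraNneq xs => <-; rewrite es mem_cat inE eqxx orbT.
apply: le_trans (cP _ _ _ es); rewrite (negbTE ks).
rewrite ler_pM2l ?ltr0n// big_seq_cond [leRHS]big_seq_cond.
rewrite le_eqVlt; apply/orP; left; apply/eqP; apply: eq_bigl => n.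
case: (eqVneq n x) => // ->; rewrite (_ : x \in s2 = false)//.
by apply: contraNF xs; rewrite es mem_cat inE => ->; rewrite !orbT.
Qed.

(* The entries right of the diagonal and those left of it are each coloured
   greedily, from the end at which the rows are empty; the product colouring then
   divides both parts of each row by [K.+1]. *)
Lemma finite_paving (R : realFieldType) (w : nat -> nat -> R) K N :
    (forall k n, 0 <= w k n)%R ->
  exists c : nat -> 'I_K.+1 * 'I_K.+1, forall k, k < N ->
    (K.+1%:R * (\sum_(0 <= n < N | (n != k) && (c n == c k)) w k n)
      <= \sum_(0 <= n < N) w k n)%R.
Proof.
move=> w0.
have [c1 c1P] := @greedy_coloring R w K (iota 0 N) (iota_uniq _ _).
have [|c2 c2P] := @greedy_coloring R w K (rev (iota 0 N)).
  by rewrite rev_uniq iota_uniq.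
exists (fun n => (c1 n, c2 n)) => k kN.
have eN : iota 0 N = iota 0 k ++ k :: iota k.+1 (N - k.+1).
  by rewrite -[k :: _]/(iota (0 + k) (N - k.+1).+1) -iotaD -addSnnS subnKC.
have eNr : rev (iota 0 N) = rev (iota k.+1 (N - k.+1)) ++ k :: rev (iota 0 k).
  by rewrite eN rev_cat rev_cons cat_rcons.
have right_le := c1P _ _ _ eN; have left_le := c2P _ _ _ eNr.
have e0 : perm_eq (rev (iota 0 k)) (iota 0 k) by rewrite perm_rev.
rewrite !(perm_big _ e0) in left_le.
have weaken (s : seq nat) (p q : pred nat) : subpred p q ->
    (\sum_(n <- s | p n) w k n <= \sum_(n <- s | q n) w k n)%R.
  move=> pq; rewrite big_mkcond [leRHS]big_mkcond; apply: ler_sum => n _.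
  by case: ifP => [/pq ->//|_]; case: ifP => // _; exact: w0.
rewrite /index_iota subn0 eN !big_cat !big_cons eqxx /= mulrDr.
apply: lerD.
  apply: le_trans left_le; rewrite ler_pM2l ?ltr0n//.
  by apply: weaken => n /andP[_ /andP[_]].
apply: ler_wpDl; first exact: w0.
apply: le_trans right_le; rewrite ler_pM2l ?ltr0n//.
by apply: weaken => n /andP[_ /andP[]].
Qed.

Lemma ultra_finType (U : Type) (I : finType) (F : set_system U) (f : U -> I) :
  UltraFilter F -> exists i, F [set u | f u = i].
Proof.
move=> FU; apply: contrapT => noi.
have : F [set u | forall i, f u != i].
  apply: filter_forall => i.
  have [Fi|] := in_ultra_setVsetC [set u | f u = i] FU.
    by case: noi; exists i.
  by apply: filterS => u /= /eqP.
by move=> /filter_ex[u /(_ (f u))]; rewrite eqxx.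
Qed.

(** [c] is the pointwise limit of [f] along an ultrafilter containing all final segments; finitely
    many agreements and a lower bound on [N] hold together on a set of the ultrafilter. *)
Lemma coloring_compactness (I : finType) (f : nat -> nat -> I) :
  exists c : nat -> I, forall m, exists2 N, m <= N & forall k, k < m -> f N k = c k.
Proof.
have [F [FU leF]] := ultraFilterLemma eventually_filter.
have /choice[c cP] k : exists i, F [set N | f N k = i] by exact: ultra_finType.
exists c => m.
have FA : F [set N | forall k : 'I_m, f N k = c k].
  by apply: filter_forall => k; exact: cP.
have Fm : F [set N | m <= N] by apply: leF; exists m.
have [N [/= fN mN]] := filter_ex (filterI FA Fm).
by exists N => // k km; exact: (fN (Ordinal km)).
Qed.

Lemma rosenthal_partial_sums (R : realType) (M : nat -> nat -> R) :
  rosenthal_matrix M ->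
  exists2 C : R, (0 <= C)%R & forall k m, (\sum_(0 <= n < m) M k n <= C)%R.
Proof.
move=> [M0 Mfin].
have sumM k m : ((\sum_(0 <= n < m) M k n)%:E <= row_sum_norm M)%E.
  apply: (@le_trans _ _ (esum setT (fun n => (M k n)%:E))).
    rewrite -nneseries_esumT; last by move=> n; rewrite lee_fin.
    rewrite -sumEFin; apply: nneseries_lim_ge => n _ _.
    by rewrite lee_fin.
  by apply: ereal_sup_ubound; exists k.
have norm0 : (0 <= row_sum_norm M)%E.
  by apply: le_trans (sumM 0 0); rewrite big_geq.
have normE : row_sum_norm M = (fine (row_sum_norm M))%:E.
  by rewrite fineK// ge0_fin_numE.
exists (fine (row_sum_norm M)); first exact: fine_ge0.
by move=> k m; rewrite -lee_fin -normE.
Qed.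

Lemma rosenthal_paving (R : realType) (M : nat -> nat -> R) (eps : R) :
    rosenthal_matrix M -> (0 < eps)%R ->
  exists (I : finType) (c : nat -> I), forall A : set nat,
    (forall k n, A k -> A n -> c n = c k) -> fragmented eps M A.
Proof.
move=> rosM eps0; have [M0 _] := rosM.
have [C C0 sumM] := rosenthal_partial_sums rosM.
(* With this [K], dividing the row bound [C] by [K.+1] gives at most [eps]. *)
pose K := Num.bound (C / eps)%R.
have CK : (C <= K.+1%:R * eps)%R.
  rewrite -ler_pdivrMr//; apply: le_trans (ltW (archi_boundP _)) _.
    by rewrite divr_ge0// ltW.
  by rewrite ler_nat.
have /choice[f fP] N := finite_paving K N M0.
have [c cP] := coloring_compactness f.
exists ('I_K.+1 * 'I_K.+1)%type, c => A Ac k Ak.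
(* It suffices to bound finite subsums. Some [f N] agrees with [c] on both [X] and [k], so the
   finite paving at [N] bounds the sum over [X]. *)
apply: ge_ereal_sup => _ [X [finX XA] <-].
have [m Xm] := finite_nat_bound finX.
have [N mN fNc] := cP (maxn m k.+1).
have km : k < maxn m k.+1 by exact: leq_maxr.
have kN := leq_trans km mN.
have Xlt n : X n -> n < maxn m k.+1 by move=> /Xm /= nm; rewrite leq_max nm.
rewrite fsbig_finite//.
pose P n := (n != k) && (f N n == f N k).
have -> : (\sum_(n <- fset_set X) (M k n)%:E = \sum_(n <- fset_set X | P n) (M k n)%:E)%E.
  rewrite big_seq [RHS]big_seq_cond; apply: eq_bigl => n.
  have [nX|//] := boolP (n \in fset_set X); rewrite /= /P.
  have {}nX : X n by move: nX; rewrite in_fset_set// => /set_mem.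
  have [An /eqP nk] := XA _ nX.
  by rewrite nk (fNc n (Xlt n nX)) (fNc k km) (Ac k n Ak An) eqxx.
apply: (@le_trans _ _ (\sum_(0 <= n < N | P n) (M k n)%:E)%E).
  apply: lee_sum_fset_nat => [n _|n /=]; first by rewrite lee_fin.
  rewrite in_fset_set// => /set_mem/Xlt nm.
  exact: leq_trans nm mN.
rewrite sumEFin lee_fin -(ler_pM2l (_ : 0 < K.+1%:R)%R) ?ltr0n//.
exact: le_trans (fP N k kN) (le_trans (sumM k N) CK).
Qed.

(** * Comparison of the two cardinals *)

Lemma reaping_rosenthal (R : realType) (F : set (set nat)) :
  reaping_family F -> exists2 H, rosenthal_family R H & H #<= F.
Proof.
move=> /reaping_coloring[H [infH HF Hcol]]; exists H => //.
split=> // M eps rosM eps0.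
have [I [c cP]] := rosenthal_paving rosM eps0.
have [k|A HA [v vP]] := Hcol #|I| (fun k => enum_rank (c k) : nat).
  exact/ltnW/ltn_ord.
exists A => //; apply: cP => k n Ak An.
by apply/enum_rank_inj/val_inj; rewrite /= !vP.
Qed.

Theorem theorem4p7 (R : realType) : ros R #= reaping_number.
Proof.
have [reapN leN] : reaping_family reaping_number /\
    forall G, reaping_family G -> reaping_number #<= G.
  apply: least_cardP; eexists; exact: reaping_family_infinite_sets.
have [H0 rosH0 H0N] := reaping_rosenthal R reapN.
have [rosR leR] : rosenthal_family R (ros R) /\
    forall G, rosenthal_family R G -> ros R #<= G.
  by apply: least_cardP; exists H0.
have [G reapG Gros] := rosenthal_reaping rosR.
apply/card_eqPle; split.
  exact: card_le_trans (leR _ rosH0) H0N.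
exact: card_le_trans (leN _ reapG) Gros.
Qed.
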